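(* Let $d\ge2$, $\omega:=\frac1{\sqrt d}\sum_{i=1}^de_i\otimes e_i\in\mathbb C^d\otimes\mathbb C^d$, $P_\omega:=\omega\omega^\ast$, and for $0\le F\le1$ let $\rho_F:=\frac{1-F}{d^2-1}(I-P_\omega)+FP_\omega$. Let $\alpha\in[1,d]$, and write $\alpha=k+\theta$ with $k=\lfloor\alpha\rfloor$, $\theta\in[0,1)$. Then $$\rho_F\in\mathsf K_\alpha\iff F\le f_d(\alpha),\qquad\text{where } f_d(\alpha):=\mu_\alpha(P_\omega)=\frac{(k+\theta)^2}{d(k+\theta^2)}.$$ In particular $f_d(k)=k/d$ for integers $k\in\{1,\dots,d\}$.
   Context: Schmidt coefficients $s_1(\psi)\ge\dots\ge s_d(\psi)\ge0$ of $\psi=\sum a_{ij}e_i\otimes e_j$ are the singular values of $[a_{ij}]$. For $\alpha\in[1,d]$ with $k=\lfloor\alpha\rfloor$, $\theta=\alpha-k$, $r=\lceil\alpha\rceil$, a unit vector $\psi$ is $\alpha$-admissible if $s_j(\psi)=0$ for $j\ge r+1$ and, when $\theta>0$, $s_{k+1}(\psi)\le\frac\theta k\sum_{j=1}^ks_j(\psi)$; $\mathcal V_\alpha$ is the set of these. $\mathsf K_\alpha$ is the closure of the convex cone generated by $\{\psi\psi^\ast:\psi\in\mathcal V_\alpha\}$ in $\mathbb M_d\otimes\mathbb M_d$. For Hermitian $W$, $\mu_\alpha(W):=\max\{\langle\psi,W\psi\rangle:\psi\in\mathcal V_\alpha\}$. *)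

(* Defs.v *)
From HB Require Import structures.
From mathcomp Require Import all_boot all_order all_algebra.
From mathcomp Require Import classical_sets reals.
From mathcomp Require Import complex.
Set Implicit Arguments. Unset Strict Implicit. Unset Printing Implicit Defensive.
Import Order.TTheory GRing.Theory Num.Theory.
Local Open Scope ring_scope.
Local Open Scope classical_set_scope.

Section Defs.
Variables (R : realType) (d : nat).
Local Notation C := R[i].

Definition adj m n (A : 'M[C]_(m, n)) : 'M[C]_(n, m) := (map_mx (@conjc R) A)^T.

(* A vector of C^d (x) C^d is a column vector of size d*d, the coordinate
   of e_i (x) e_j being at index mxvec_index i j (Kronecker ordering).
   Operators on C^d (x) C^d, i.e. elements of M_d (x) M_d, are
   (d*d) x (d*d) matrices. *)
Definition coef_mx (psi : 'cV[C]_(d * d)) : 'M[C]_d :=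
  \matrix_(i, j) psi (mxvec_index i j) 0.

Definition unitary (U : 'M[C]_d) : Prop := U *m adj U = 1%:M.

Definition schmidt_coeffs (psi : 'cV[C]_(d * d)) (s : 'I_d -> R) : Prop :=
  (forall i j : 'I_d, (i <= j)%N -> s j <= s i) /\
  (forall i, 0 <= s i) /\
  exists U V : 'M[C]_d, [/\ unitary U, unitary V &
    coef_mx psi = U *m diag_mx (\row_i (s i)%:C%C) *m V].

Definition unit_vec (psi : 'cV[C]_(d * d)) : Prop := (adj psi *m psi) 0 0 = 1.

(* alpha-admissible unit vectors (0-based indices: s j is s_{j+1}) *)
Definition admissible (alpha : R) (psi : 'cV[C]_(d * d)) : Prop :=
  let k := Num.floor alpha in
  let theta := alpha - k%:~R in
  let r := Num.ceil alpha in
  unit_vec psi /\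
  exists s : 'I_d -> R, [/\ schmidt_coeffs psi s,
    (forall j : 'I_d, (r <= (j : nat)%:Z) -> s j = 0) &
    (0 < theta -> forall j : 'I_d, (j : nat)%:Z = k ->
        s j <= theta / k%:~R * \sum_(i < d | ((i : nat)%:Z < k)) s i)].

(* K_alpha: closure (entrywise) of the convex cone generated by psi psi^*,
   psi alpha-admissible *)
Definition in_K (alpha : R) (rho : 'M[C]_(d * d)) : Prop :=
  forall eps : R, 0 < eps ->
  exists (n : nat) (c : 'I_n -> R) (phi : 'I_n -> 'cV[C]_(d * d)),
    [/\ forall l, 0 <= c l, forall l, admissible alpha (phi l) &
      forall i j, `| rho i j - (\sum_(l < n) (c l)%:C%C *: (phi l *m adj (phi l))) i j |
                  < eps%:C%C].

Definition qform (W : 'M[C]_(d * d)) (psi : 'cV[C]_(d * d)) : C :=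
  (adj psi *m W *m psi) 0 0.

(* mu_alpha(W) = max over V_alpha of <psi, W psi> (real for Hermitian W) *)
Definition mu (alpha : R) (W : 'M[C]_(d * d)) : R :=
  sup [set complex.Re (qform W psi) | psi in admissible alpha].

Definition omega : 'cV[C]_(d * d) :=
  \col_k \sum_(i < d) (if k == mxvec_index i i then ((Num.sqrt (d%:R : R))^-1)%:C%C else 0).

Definition P_omega : 'M[C]_(d * d) := omega *m adj omega.

Definition rho (F : R) : 'M[C]_(d * d) :=
  ((1 - F) / (d%:R ^+ 2 - 1))%:C%C *: (1%:M - P_omega) + F%:C%C *: P_omega.

Definition fd (alpha : R) : R :=
  let k : R := (Num.floor alpha)%:~R in
  let theta := alpha - k in
  (k + theta) ^+ 2 / (d%:R * (k + theta ^+ 2)).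

End Defs.

Arguments mu {R} d alpha W.
Arguments in_K {R} d alpha rho.
Arguments admissible {R} d alpha psi.

(* Main.v *)
(* Write a vector of C^d (x) C^d as a d x d matrix A.  Its overlap with omega
   is |tr A|^2 / d, and |tr A| is at most the sum of the Schmidt coefficients,
   so mu_alpha(P_omega) is an elementary maximization over admissible profiles
   (k equal coefficients followed by theta times their common value).  The
   functional X |-> <omega, X omega> - f_d(alpha) tr X is then nonpositive on
   K_alpha and equals F - f_d(alpha) at rho_F.

   Conversely, no integral over the unitary group is needed.  Averaging
   A |-> U A adj(U) over the finite group of monomial matrices with entries in
   {1, i, -1, -i} gives an operator determined by tr(A adj(A)), |tr A|^2
   and q = sum_i |a_ii|^2, and it is the isotropic state with F = |tr A|^2 / d as soon
   as q = (dF + 1) / (d + 1).  This value of q is reached by mixing the averages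
   of A and of its conjugate by the Fourier matrix: for a diagonal A the two
   values of q are 1 and F, for the matrix unit E_01 (with F = 0) they are 0 and
   1 / d.  This gives F = f_d(alpha) and F = 0, hence everything in between. *)
Require Import Defs.
From HB Require Import structures.
From mathcomp Require Import all_boot all_order all_algebra.
From mathcomp Require Import classical_sets reals.
From mathcomp Require Import complex.
From mathcomp Require Import fingroup perm cyclic separable cyclotomic.
From mathcomp Require Import zify ring lra.
Set Implicit Arguments. Unset Strict Implicit. Unset Printing Implicit Defensive.
Import Order.TTheory GRing.Theory Num.Theory.
Local Open Scope ring_scope.

(** * Vectors of the tensor product viewed as square matrices *)

Section Vectorization.
Variables (R : realType) (d : nat).
Local Notation C := R[i].
Implicit Types (A B U V : 'M[C]_d) (psi : 'cV[C]_(d * d)).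

Definition vec A : 'cV[C]_(d * d) := (mxvec A)^T.

Lemma vecE A i j : vec A (mxvec_index i j) 0 = A i j.
Proof. by rewrite mxE mxvecE. Qed.

Lemma coef_mxK : cancel (@coef_mx R d) vec.
Proof.
by move=> psi; apply/colP; case/mxvec_indexP=> i j; rewrite vecE mxE.
Qed.

Lemma vecK : cancel vec (@coef_mx R d).
Proof. by move=> A; apply/matrixP=> i j; rewrite mxE vecE. Qed.

Lemma adjE m n (A : 'M[C]_(m, n)) i j : adj A i j = (A j i)^*%C.
Proof. by rewrite !mxE. Qed.

Lemma adjM m n p (A : 'M[C]_(m, n)) (B : 'M[C]_(n, p)) :
  adj (A *m B) = adj B *m adj A.
Proof. by rewrite /adj map_mxM trmx_mul. Qed.

Lemma adjK m n (A : 'M[C]_(m, n)) : adj (adj A) = A.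
Proof. by apply/matrixP=> i j; rewrite !adjE conjcK. Qed.

Lemma big_mxvec (F : 'I_(d * d) -> C) :
  \sum_k F k = \sum_i \sum_j F (mxvec_index i j).
Proof.
rewrite (reindex _ (curry_mxvec_bij _ _)) /=.
by rewrite pair_big; apply: eq_bigr => -[].
Qed.

Lemma tr_mul_adj A : \tr (A *m adj A) = \sum_i \sum_j `|A i j| ^+ 2.
Proof.
apply: eq_bigr => i _; rewrite mxE; apply: eq_bigr => j _.
by rewrite adjE sqr_normc.
Qed.

Lemma unit_vecE A : unit_vec (vec A) <-> \tr (A *m adj A) = 1.
Proof.
rewrite /unit_vec mxE big_mxvec tr_mul_adj.
under eq_bigr => i _ do under eq_bigr => j _ do
  rewrite adjE vecE mulrC -sqr_normc.
by [].
Qed.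

Lemma dyadE A i j k l :
  (vec A *m adj (vec A)) (mxvec_index i j) (mxvec_index k l)
    = A i j * (A k l)^*%C.
Proof. by rewrite mxE big_ord1 adjE !vecE. Qed.

(** The left side is d times the overlap of the dyad with [omega], kept as a double sum of entries
    because that form is linear in the operator and extends to sums of dyads. *)
Lemma sum_diag_dyad A :
  \sum_i \sum_k (vec A *m adj (vec A)) (mxvec_index i i) (mxvec_index k k)
    = `|\tr A| ^+ 2.
Proof.
rewrite sqr_normc rmorph_sum mulr_suml; apply: eq_bigr => i _.
by rewrite mulr_sumr; apply: eq_bigr => k _; rewrite dyadE.
Qed.

Lemma trace_dyad psi : unit_vec psi -> \tr (psi *m adj psi) = 1.
Proof. by move=> n1; rewrite -[RHS]n1 mxtrace_mulC /mxtrace big_ord1. Qed.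

Lemma mxvec_index_eq (i j k l : 'I_d) :
  (mxvec_index i j == mxvec_index k l) = (i == k) && (j == l).
Proof.
rewrite /mxvec_index (inj_eq (@cast_ord_inj _ _ _)) (inj_eq enum_rank_inj).
by rewrite xpair_eqE.
Qed.

Definition isqrt_dim : C := ((Num.sqrt (d%:R : R))^-1)%:C%C.

Lemma isqrt_dim_sqr : isqrt_dim * isqrt_dim = d%:R^-1.
Proof.
rewrite -rmorphM /= -invfM -expr2 sqr_sqrtr ?ler0n //.
by rewrite fmorphV rmorph_nat.
Qed.

Lemma omegaE : omega R d = vec (isqrt_dim%:M).
Proof.
apply/colP; case/mxvec_indexP=> i j; rewrite vecE !mxE.
case: eqVneq => [<-|ne_ij].
  rewrite (bigD1 i) //= eqxx big1 ?addr0 // => k ne_ki.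
  by rewrite mxvec_index_eq eq_sym (negPf ne_ki).
rewrite mulr0n big1 // => k _; rewrite mxvec_index_eq.
by case: eqP => // <-; rewrite eq_sym (negPf ne_ij).
Qed.

Lemma adj_omega_vec A : (adj (omega R d) *m vec A) 0 0 = isqrt_dim * \tr A.
Proof.
rewrite mxE big_mxvec mulr_sumr; apply: eq_bigr => i _.
rewrite (bigD1 i) //= big1 => [|j ne_ji]; rewrite omegaE adjE !vecE mxE.
  by rewrite eqxx mulr1n conjc_real addr0.
by rewrite eq_sym (negPf ne_ji) conjc0 mul0r.
Qed.

Lemma P_omegaE i j k l :
  P_omega R d (mxvec_index i j) (mxvec_index k l)
    = d%:R^-1 *+ ((i == j) && (k == l)).
Proof.
rewrite /P_omega omegaE dyadE !mxE -isqrt_dim_sqr.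
case: eqP => _; last by rewrite mulr0n mul0r.
case: eqP => _; last by rewrite !mulr0n conjc0 mulr0.
by rewrite conjc_real.
Qed.

Lemma qform_P_omega A : qform (P_omega R d) (vec A) = `|\tr A| ^+ 2 / d%:R.
Proof.
rewrite /qform /P_omega mulmxA -mulmxA mxE big_ord1 adj_omega_vec.
have -> : adj (vec A) *m omega R d = adj (adj (omega R d) *m vec A).
  by rewrite adjM adjK.
rewrite adjE adj_omega_vec -isqrt_dim_sqr sqr_normc rmorphM.
rewrite /= [X in X * _ * _]conjc_real mulrACA [RHS]mulrC.
by rewrite [\tr A * _]mulrC.
Qed.

End Vectorization.

(** * Unitary matrices and Schmidt coefficients *)

Section Unitary.
Variables (R : realType) (d : nat).
Local Notation C := R[i].
Implicit Types (A B U V : 'M[C]_d).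

Lemma unitary1 : unitary (1%:M : 'M[C]_d).
Proof.
by rewrite /unitary mul1mx; apply/matrixP=> i j; rewrite adjE !mxE eq_sym conjc_nat.
Qed.

Lemma unitary_adjl U : unitary U -> adj U *m U = 1%:M.
Proof. exact: mulmx1C. Qed.

Lemma unitary_adj U : unitary U -> unitary (adj U).
Proof. by move=> uU; rewrite /unitary adjK unitary_adjl. Qed.

Lemma unitaryM U V : unitary U -> unitary V -> unitary (U *m V).
Proof.
by rewrite /unitary adjM => uU uV; rewrite mulmxA -(mulmxA U) uV mulmx1.
Qed.

Lemma unitary_perm_mx (s : 'S_d) : unitary (perm_mx s : 'M[C]_d).
Proof.
have E : adj (perm_mx s) = (perm_mx s)^T :> 'M[C]_d.
  by apply/matrixP=> l m; rewrite adjE !mxE conjc_nat.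
by rewrite /unitary E tr_perm_mx -perm_mxM mulgV perm_mx1.
Qed.

(** The diagonal entry of [U *m adj U] at i is the squared norm of row i, and it equals 1. *)
Lemma unitary_entry_le1 U i j : unitary U -> `|U i j| <= 1.
Proof.
move=> uU; rewrite -(@expr_le1 _ 2%N) ?normr_ge0 //.
have := congr1 (fun M : 'M[C]_d => M i i) uU; rewrite !mxE eqxx mulr1n => <-.
rewrite (bigD1 j) //= adjE -sqr_normc lerDl sumr_ge0 // => k _.
by rewrite adjE -sqr_normc exprn_ge0.
Qed.

Lemma tr_conj U A : unitary U -> \tr (U *m A *m adj U) = \tr A.
Proof. by move=> uU; rewrite mxtrace_mulC mulmxA unitary_adjl ?mul1mx. Qed.

Lemma unit_vec_conj U A :
  unitary U -> unit_vec (vec A) -> unit_vec (vec (U *m A *m adj U)).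
Proof.
move=> uU /unit_vecE nA; apply/unit_vecE; rewrite -nA -[RHS](tr_conj _ uU).
by rewrite !adjM adjK !mulmxA -(mulmxA (U *m A)) unitary_adjl // mulmx1.
Qed.

(** Conjugation only changes the two unitary factors of a singular value decomposition, so the same
    [s] serves. *)
Lemma admissible_conj alpha U A : unitary U ->
  admissible d alpha (vec A) -> admissible d alpha (vec (U *m A *m adj U)).
Proof.
move=> uU [nA [s [[s_mono [s_ge0 [V [W [uV uW AE]]]]] s0 sk]]].
split; first exact: unit_vec_conj.
exists s; split=> //; split=> //; split=> //.
exists (U *m V), (W *m adj U); split; try exact: unitaryM.
  by apply: unitaryM => //; exact: unitary_adj.
by move: AE; rewrite !vecK => ->; rewrite !mulmxA.
Qed.

Lemma schmidt_norm (s : 'I_d -> R) psi : schmidt_coeffs psi s ->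
  unit_vec psi -> \sum_i s i ^+ 2 = 1.
Proof.
move=> [_ [s_ge0 [U [V [uU uV]]]]].
rewrite -{2}(coef_mxK psi) unit_vecE => -> n1.
apply: complexI; rewrite rmorph1 -n1 !adjM !mulmxA.
rewrite -(mulmxA (U *m _) V) uV mulmx1 -(mulmxA U) tr_conj // rmorph_sum.
rewrite tr_mul_adj; apply: eq_bigr => i _.
rewrite (bigD1 i) //= big1 => [|j ne_ji]; rewrite !mxE.
  by rewrite eqxx mulr1n addr0 ger0_norm ?lecR // rmorphXn.
by rewrite eq_sym (negPf ne_ji) normr0 expr0n.
Qed.

(** By cyclicity the trace of U D V is the sum of the [s i] weighted by the diagonal entries of the
    unitary V U, which have modulus at most 1. *)
Lemma schmidt_tr_le (s : 'I_d -> R) psi : schmidt_coeffs psi s ->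
  `|\tr (coef_mx psi)| <= (\sum_i s i)%:C%C.
Proof.
move=> [_ [s_ge0 [U [V [uU uV ->]]]]].
rewrite mxtrace_mulC mulmxA rmorph_sum /=.
apply: le_trans (ler_norm_sum _ _ _) _; apply: ler_sum => i _.
rewrite mul_mx_diag !mxE normrM.
rewrite (@ger0_norm _ (s i)%:C%C) ?lecR //.
have := unitary_entry_le1 i i (unitaryM uV uU); rewrite mxE => le1.
by apply: ler_piMl; rewrite // lecR.
Qed.

End Unitary.

(** * Maximizing the sum of an admissible profile *)

Section SchmidtProfile.
Variables (R : realType) (d : nat).
Local Notation C := R[i].
Implicit Types (k : nat) (theta : R) (s : 'I_d -> R).

Lemma floor_natD k theta : 0 <= theta < 1 -> Num.floor (k%:R + theta) = k%:Z.
Proof. by move=> th; apply: floor_def; rewrite intrD -pmulrn; lra. Qed.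

Lemma ceil_natD k theta : 0 <= theta < 1 ->
  Num.ceil (k%:R + theta) = (k + (0 < theta)%R)%N%:Z.
Proof.
move=> th; apply: ceil_def; rewrite intrB PoszD intrD -!pmulrn.
by case: (ltP 0 theta) => th0; rewrite /= ?mulr1n ?mulr0n; lra.
Qed.

(* For theta = 0 the bound at j = k reads s k <= 0, which is what the condition
   j >= ceil alpha demands there: the two cases merge. *)
Lemma admissible_natD k theta psi : (0 < k)%N -> 0 <= theta < 1 ->
  admissible d (k%:R + theta) psi <->
  unit_vec psi /\ exists s : 'I_d -> R, [/\ schmidt_coeffs psi s,
    (forall j : 'I_d, (k < j)%N -> s j = 0) &
    (forall j : 'I_d, (j : nat) = k ->
       s j <= theta / k%:R * \sum_(i < d | (i < k)%N) s i)].
Proof.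
move=> k_gt0 th; rewrite /admissible floor_natD // ceil_natD //.
rewrite -[k%:~R]pmulrn addrC addKr; split=> -[nu [s [schm s0 sk]]]; split=> //.
  exists s; split=> // j => [ltkj|jk].
    by apply: s0; rewrite lez_nat; case: (0 < theta); lia.
  case: (ltP 0 theta) => th0; first by apply: (sk th0 j); rewrite jk.
  have -> : theta = 0 by lra.
  rewrite mul0r mul0r s0 // lez_nat jk; case: ltP => //; first by lra.
  by rewrite addn0.
exists s; split=> // [j|th0 j [jk]]; last exact: sk.
rewrite lez_nat; case: ltP => th0 lekj; first by apply: s0; lia.
have [/s0 //|] := ltnP k j; rewrite leq_eqVlt => /orP[/eqP jk|]; last by lia.
apply/eqP; rewrite eq_le; case: schm => _ [s_ge0 _]; rewrite s_ge0 andbT.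
have := sk j jk; have -> : theta = 0 by lra.
by rewrite !mul0r.
Qed.

(** The profile consists of k coefficients equal to [m] followed by [t]; equality holds at
    [t = theta * m], the largest value allowed. *)
Lemma profile_le (k theta m t : R) : 1 <= k -> 0 <= theta <= 1 ->
  0 <= t <= theta * m -> 0 <= m ->
  (k * m + t) ^+ 2 * (k + theta ^+ 2) <= (k + theta) ^+ 2 * (k * m ^+ 2 + t ^+ 2).
Proof.
move=> k1 th tm m0; rewrite -subr_ge0.
(* The difference of the two sides is a quadratic form in [m] and [t] that vanishes at
   [t = theta * m]; [a] and [b] are the coefficients of the other linear factor. *)
pose a := 2 * k ^+ 2 + k * theta - k ^+ 2 * theta.
pose b := k ^+ 2 + 2 * k * theta - k.
have -> : (k + theta) ^+ 2 * (k * m ^+ 2 + t ^+ 2)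
          - (k * m + t) ^+ 2 * (k + theta ^+ 2)
        = (theta * m - t) * (a * m - b * t) by rewrite /a /b; ring.
apply: mulr_ge0; first lra.
(* As [b] is nonnegative, the second factor is smallest at [t = theta * m], where it equals
   [(a - b * theta) * m]. *)
have b0 : 0 <= b by rewrite /b; nra.
have : b * t <= b * (theta * m) by apply: ler_wpM2l; lra.
have : 0 <= (a - b * theta) * m.
  apply: mulr_ge0 => //.
  have -> : a - b * theta = 2 * k * (k + theta) * (1 - theta).
    by rewrite /a /b; ring.
  by apply: mulr_ge0; [apply: mulr_ge0; lra|lra].
nra.
Qed.

Lemma sum_step (k : nat) (a b : R) : (k <= d)%N -> (k = d -> b = 0) ->
  \sum_(i < d) (if (i < k)%N then a else if i == k :> nat then b else 0)
    = k%:R * a + b.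
Proof.
move=> le_kd bd; rewrite (bigID (fun i : 'I_d => (i < k)%N)) /=.
congr (_ + _).
  rewrite (eq_bigr (fun=> a)) => [|i ->] //.
  by rewrite (big_ord_narrow le_kd) sumr_const card_ord mulr_natl.
have [lt_kd|le_dk] := ltnP k d.
  rewrite (bigD1 (Ordinal lt_kd)) /= ?ltnn // eqxx big1 ?addr0 // => i.
  by case/andP=> /negPf -> /negPf; rewrite -val_eqE /= => ->.
rewrite bd ?big1 // => [i|]; last by apply/eqP; rewrite eqn_leq le_kd.
by have := leq_trans (ltn_ord i) le_dk => ->.
Qed.

(** Replacing the first k coefficients by their mean [m] keeps their sum and does not increase the
    sum of squares, which reduces the claim to [profile_le]. *)
Lemma sum_schmidt_le k theta s : (0 < k <= d)%N -> 0 <= theta <= 1 ->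
  (forall i, 0 <= s i) -> (forall j : 'I_d, (k < j)%N -> s j = 0) ->
  (forall j : 'I_d, (j : nat) = k ->
     s j <= theta / k%:R * \sum_(i < d | (i < k)%N) s i) ->
  (\sum_i s i) ^+ 2 * (k%:R + theta ^+ 2)
    <= (k%:R + theta) ^+ 2 * \sum_i s i ^+ 2.
Proof.
move=> /andP[k_gt0 le_kd] th s_ge0 s0 sk.
have k1 : 1 <= k%:R :> R by rewrite ler1n.
set S := \sum_(i < d | _) s i in sk; pose m := S / k%:R.
have SE : S = k%:R * m by rewrite mulrC divfK //; lra.
have m0 : 0 <= m by rewrite divr_ge0 ?sumr_ge0 ?ler0n.
rewrite [\sum_i s i](bigID (fun i : 'I_d => (i < k)%N)) /= -/S SE.
rewrite [\sum_i s i ^+ 2](bigID (fun i : 'I_d => (i < k)%N)) /=.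
(* Cauchy-Schwarz, obtained by expanding the variance of the first k coefficients. *)
have sumsq : k%:R * m ^+ 2 <= \sum_(i < d | (i < k)%N) s i ^+ 2.
  have : 0 <= \sum_(i < d | (i < k)%N) (s i - m) ^+ 2.
    by apply: sumr_ge0 => i _; exact: sqr_ge0.
  rewrite (eq_bigr (fun i => (s i ^+ 2 - 2 * m * s i) + m ^+ 2)) => [|i _]; last by ring.
  rewrite big_split sumrB /= -mulr_sumr -/S.
  rewrite [X in _ + X](big_ord_narrow le_kd) sumr_const card_ord -mulr_natl SE.
  by set X := \sum_(i < d | _) _; nra.
(* The tail is the single coefficient of index k, or is empty when [k = d], in which case
   [t = 0]. *)
have [t [-> -> tm]] : exists t : R,
    [/\ \sum_(i < d | ~~ (i < k)%N) s i = t,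
        \sum_(i < d | ~~ (i < k)%N) s i ^+ 2 = t ^+ 2 & 0 <= t <= theta * m].
  have [lt_kd|le_dk] := ltnP k d.
    have s0' (i : 'I_d) : ~~ (i < k)%N && (i != Ordinal lt_kd) -> s i = 0.
      by rewrite -leqNgt -val_eqE /= => ?; apply: s0; lia.
    exists (s (Ordinal lt_kd)); split.
    - rewrite (bigD1 (Ordinal lt_kd)) /= ?ltnn //.
      by rewrite big1 ?addr0 // => i /s0'.
    - rewrite (bigD1 (Ordinal lt_kd)) /= ?ltnn //.
      by rewrite big1 ?addr0 // => i /s0' ->; rewrite expr0n.
    - by rewrite s_ge0 /m mulrA mulrAC sk.
  have F (i : 'I_d) : ~~ (i < k)%N -> False.
    by rewrite (leq_trans (ltn_ord i) le_dk).
  exists 0; split; try by rewrite big1 ?expr0n // => i /F.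
  by rewrite lexx mulr_ge0 //; lra.
apply: le_trans (profile_le k1 th tm m0) _.
apply: ler_wpM2l; first exact: sqr_ge0.
lra.
Qed.

End SchmidtProfile.

(** * The maximal overlap with [omega] *)

Section Fidelity.
Variables (R : realType) (d : nat).
Local Notation C := R[i].
Implicit Types (k : nat) (theta : R).

Lemma fd_natD k theta : 0 <= theta < 1 ->
  fd d (k%:R + theta) = (k%:R + theta) ^+ 2 / (d%:R * (k%:R + theta ^+ 2)).
Proof. by move=> th; rewrite /fd floor_natD // -pmulrn addrAC subrr add0r. Qed.

Lemma fd_ge0 (alpha : R) : 1 <= alpha -> 0 <= fd d alpha.
Proof.
move=> alpha1; rewrite divr_ge0 ?sqr_ge0 // mulr_ge0 // addr_ge0 ?sqr_ge0 //.
by rewrite ler0z floor_ge0; lra.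
Qed.

(** The factor [V] lets one criterion serve both the diagonal maximizer, with [V] the identity, and
    a matrix unit, with [V] a permutation matrix. *)
Lemma admissible_diag_mul k theta (s : 'I_d -> R) (V : 'M[C]_d) :
  (0 < k)%N -> 0 <= theta < 1 ->
  (forall i j : 'I_d, (i <= j)%N -> s j <= s i) -> (forall i, 0 <= s i) ->
  (forall j : 'I_d, (k < j)%N -> s j = 0) ->
  (forall j : 'I_d, (j : nat) = k ->
     s j <= theta / k%:R * \sum_(i < d | (i < k)%N) s i) ->
  \sum_i s i ^+ 2 = 1 -> unitary V ->
  admissible d (k%:R + theta) (vec (diag_mx (\row_i (s i)%:C%C) *m V)).
Proof.
move=> k_gt0 th s_mono s_ge0 s0 sk s1 uV; apply/admissible_natD => //; split.
  apply/unit_vecE; rewrite adjM mulmxA -(mulmxA _ V) uV mulmx1 tr_mul_adj.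
  rewrite -[1](rmorph1 (real_complex R)) -s1 rmorph_sum; apply: eq_bigr => i _.
  rewrite (bigD1 i) //= big1 => [|j ne_ji]; rewrite !mxE.
    by rewrite eqxx mulr1n addr0 ger0_norm ?lecR // rmorphXn.
  by rewrite eq_sym (negPf ne_ji) normr0 expr0n.
exists s; split=> //; split=> //; split=> //; exists 1%:M, V; split=> //.
  exact: unitary1.
by rewrite vecK mul1mx.
Qed.

Lemma delta_admissible k theta (i j : 'I_d) : (0 < k)%N -> 0 <= theta < 1 ->
  (i : nat) = 0%N ->
  admissible d (k%:R + theta) (vec (delta_mx i j)).
Proof.
move=> k_gt0 th i0; pose s (l : 'I_d) : R := (l == i)%:R.
have sN0 (l : 'I_d) : (0 < l)%N -> s l = 0.
  by rewrite /s -val_eqE /= i0 => /gtn_eqF ->.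
(* Row i of the matrix of the transposition is the basis row j, so it carries the diagonal unit at i
   to the unit at (i, j). With i = 0 the only nonzero coefficient comes first, as the decreasing
   order demands. *)
have -> : delta_mx i j = diag_mx (\row_l (s l)%:C%C) *m perm_mx (tperm i j).
  apply/matrixP=> l m; rewrite mul_diag_mx !mxE /s.
  case: eqP => [->|_]; last by rewrite mul0r.
  by rewrite tpermL mul1r eq_sym.
apply: admissible_diag_mul => //.
- move=> l m le_lm; rewrite /s ler_nat.
  rewrite -!val_eqE /= i0; case: (m : nat) le_lm => [|m'] //=.
  by rewrite leqn0 => ->.
- by move=> l ltkl; apply: sN0; lia.
- move=> l lk; rewrite sN0 ?lk // mulr_ge0 ?sumr_ge0 //.
  by rewrite divr_ge0 ?ler0n //; lra.
- rewrite (bigD1 i) //= /s eqxx expr1n big1 ?addr0 // => l /negPf ->.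
  by rewrite expr0n.
- exact: unitary_perm_mx.
Qed.

Hypothesis d_gt0 : (0 < d)%N.

Lemma fd_nat k : (0 < k)%N -> fd d (k%:R : R) = k%:R / d%:R.
Proof.
move=> k_gt0; rewrite -[k%:R in LHS]addr0 fd_natD ?lexx ?ltr01 //.
by rewrite expr0n !addr0; field; rewrite !pnatr_eq0; lia.
Qed.

(** The overlap is at most the squared sum of the Schmidt coefficients over d, and [sum_schmidt_le]
    bounds that sum since the squares add up to 1. The order is that of the complex numbers, so the
    overlap is also asserted to be real. *)
Lemma qform_P_omega_admissible_le k theta psi :
  (0 < k <= d)%N -> 0 <= theta < 1 -> admissible d (k%:R + theta) psi ->
  qform (P_omega R d) psi <= (fd d (k%:R + theta))%:C%C.
Proof.
move=> kd th /admissible_natD[]//; first by case/andP: kd.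
move=> nu [s [schm s0 sk]].
have k1 : 1 <= k%:R :> R by rewrite ler1n; case/andP: kd.
have d1 : 1 <= d%:R :> R by rewrite ler1n.
have s_ge0 : forall i, 0 <= s i by case: schm => _ [].
rewrite -(coef_mxK psi) qform_P_omega.
apply: (@le_trans _ _ ((\sum_i s i) ^+ 2 / d%:R)%:C%C).
  rewrite rmorphM rmorphXn fmorphV rmorph_nat /=.
  rewrite ler_wpM2r ?invr_ge0 ?ler0n // lerXn2r ?nnegrE //.
    by rewrite lecR sumr_ge0.
  exact: schmidt_tr_le.
rewrite lecR fd_natD // invfM mulrCA mulrC ler_wpM2l ?invr_ge0 ?ler0n //.
have th01 : 0 <= theta <= 1 by lra.
have := sum_schmidt_le kd th01 s_ge0 s0 sk.
by rewrite (schmidt_norm schm nu) mulr1 ler_pdivlMr //; nra.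
Qed.

(** This is the equality case of [profile_le]. The last clause records the value of q, which mixing
    the twirls requires. *)
Lemma extremal_admissible k theta :
  (0 < k <= d)%N -> 0 <= theta < 1 -> (k = d -> theta = 0) ->
  exists v : 'rV[C]_d, [/\ admissible d (k%:R + theta) (vec (diag_mx v)),
    `|\tr (diag_mx v)| ^+ 2 = (d%:R * fd d (k%:R + theta))%:C%C &
    \sum_i `|v 0 i| ^+ 2 = 1].
Proof.
move=> /andP[k_gt0 le_kd] th kdth.
have k1 : 1 <= k%:R :> R by rewrite ler1n.
have d1 : 1 <= d%:R :> R by rewrite ler1n.
have D0 : 0 < k%:R + theta ^+ 2 by nra.
(* The common value that normalizes k coefficients [u] followed by [theta * u]. *)
pose u := (Num.sqrt (k%:R + theta ^+ 2))^-1.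
have u0 : 0 <= u by rewrite invr_ge0 sqrtr_ge0.
have uE : u ^+ 2 = (k%:R + theta ^+ 2)^-1 by rewrite exprVn sqr_sqrtr // ltW.
have u1 : u ^+ 2 * (k%:R + theta ^+ 2) = 1 by rewrite uE mulVf // gt_eqF.
pose s (i : 'I_d) := if (i < k)%N then u else if i == k :> nat then theta * u else 0.
have s_ge0 i : 0 <= s i by rewrite /s; case: ifP => // _; case: ifP => // _; nra.
have sumS : \sum_i s i = (k%:R + theta) * u.
  by rewrite sum_step // ?mulrDl // => /kdth ->; rewrite mul0r.
have sumsq : \sum_i s i ^+ 2 = 1.
  rewrite (eq_bigr (fun i : 'I_d => if (i < k)%N then u ^+ 2
                    else if i == k :> nat then (theta * u) ^+ 2 else 0)).
    rewrite sum_step // => [|/kdth ->]; last by rewrite mul0r expr0n.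
    by rewrite -[RHS]u1; ring.
  by move=> i _; rewrite /s; do 2 case: ifP => // _; rewrite expr0n.
exists (\row_i (s i)%:C%C); split.
- rewrite -[diag_mx _]mulmx1; apply: admissible_diag_mul => //.
  + move=> i j le_ij; rewrite /s.
    case: (ltnP i k) => ik; case: (ltnP j k) => jk; try lia.
    * by [].
    * by case: ifP => // _; nra.
    * case: eqP => [jE|_]; case: eqP => [iE|iE] //; first lia.
      by rewrite mulr_ge0 //; lra.
  + by move=> j ltkj; rewrite /s ltnNge ltnW //= gtn_eqF.
  + move=> j jk; rewrite /s jk ltnn eqxx (eq_bigr (fun=> u)) => [|i ->] //.
    rewrite (big_ord_narrow le_kd) sumr_const card_ord -[u *+ _]mulr_natl.
    by rewrite mulrA divfK //; lra.
  + exact: unitary1.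
- have -> : \tr (diag_mx (\row_i (s i)%:C%C)) = (\sum_i s i)%:C%C.
    by rewrite rmorph_sum; apply: eq_bigr => i _; rewrite !mxE eqxx.
  rewrite ger0_norm ?lecR ?sumr_ge0 // -rmorphXn sumS exprMn uE fd_natD //.
  by congr (_%:C%C); field; apply/andP; split; lra.
- rewrite -[1](rmorph1 (real_complex R)) -sumsq rmorph_sum.
  apply: eq_bigr => i _; rewrite !mxE.
  by rewrite ger0_norm ?lecR // rmorphXn.
Qed.

Lemma mu_P_omega k theta :
  (0 < k <= d)%N -> 0 <= theta < 1 -> (k = d -> theta = 0) ->
  mu d (k%:R + theta) (P_omega R d) = fd d (k%:R + theta).
Proof.
move=> kd th kdth.
have [v [adA trA _]] := extremal_admissible kd th kdth.
rewrite /mu; set S := (X in sup X).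
have ubS : ubound S (fd d (k%:R + theta)).
  move=> _ [psi ad_psi <-].
  by have := qform_P_omega_admissible_le kd th ad_psi; rewrite lecE => /andP[].
have inS : S (fd d (k%:R + theta)).
  exists (vec (diag_mx v)) => //; rewrite qform_P_omega trA.
  rewrite -(rmorph_nat (real_complex R)) -fmorphV -rmorphM /=.
  by rewrite mulrC mulKf // pnatr_eq0 -lt0n.
apply/eqP; rewrite eq_le ge_sup //=; last by exists (fd d (k%:R + theta)).
by apply: ub_le_sup => //; exists (fd d (k%:R + theta)).
Qed.

End Fidelity.

(** The last clause comes from [alpha <= d]: at [k = d] there is no index left to carry a
    coefficient proportional to [theta]. *)
Lemma archi_split (R : realType) (d : nat) (alpha : R) : 1 <= alpha <= d%:R ->
  exists (k : nat) (theta : R), [/\ alpha = k%:R + theta, (0 < k <= d)%N,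
    0 <= theta < 1 & k = d -> theta = 0].
Proof.
move=> /andP[a1 ad]; have fl1 : 0 < Num.floor alpha by rewrite floor_gt0.
case E: (Num.floor alpha) fl1 => [k|//] k_gt0.
have := floor_itv alpha; rewrite E intrD -pmulrn => /andP[ka ak].
exists k, (alpha - k%:R); split; try lra.
- by apply/andP; split=> //; rewrite -(ler_nat R); exact: le_trans ka ad.
- by move=> kd; rewrite kd in ka *; lra.
Qed.

(** * The convex cone before closure *)

Section Cone.
Variables (R : realType) (d : nat) (alpha : R).
Local Notation C := R[i].
Implicit Types X Y : 'M[C]_(d * d).

(** An arbitrary finite index type lets sums run over disjoint unions and over the monomial group
    without renumbering. *)
Definition in_cone X : Prop :=
  exists (I : finType) (c : I -> R) (phi : I -> 'cV[C]_(d * d)),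
    [/\ forall l, 0 <= c l, forall l, admissible d alpha (phi l) &
        X = \sum_l (c l)%:C%C *: (phi l *m adj (phi l))].

Lemma in_coneD X Y : in_cone X -> in_cone Y -> in_cone (X + Y).
Proof.
move=> [I [c [phi [c0 ad ->]]]] [J [e [psi [e0 ad' ->]]]].
exists (I + J)%type, (fun l => match l with inl i => c i | inr j => e j end).
exists (fun l => match l with inl i => phi i | inr j => psi j end).
split; [by case | by case |].
by rewrite big_sumType.
Qed.

Lemma in_coneZ (a : R) X : 0 <= a -> in_cone X -> in_cone (a%:C%C *: X).
Proof.
move=> a0 [I [c [phi [c0 ad ->]]]].
exists I, (fun l => a * c l), phi; split=> // [l|]; first exact: mulr_ge0.
by rewrite scaler_sumr; apply: eq_bigr => l _; rewrite scalerA rmorphM.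
Qed.

Lemma in_cone_in_K X : in_cone X -> in_K d alpha X.
Proof.
move=> [I [c [phi [c0 ad ->]]]] eps eps0.
exists #|I|, (c \o enum_val), (phi \o enum_val); split=> // [l|l|i j] /=.
- exact: c0.
- exact: ad.
by rewrite big_enum_val /= subrr normr0 ltcR.
Qed.

End Cone.

(** * Twirling over the monomial group *)

Section Twirl.
Variables (R : realType) (d : nat).
Local Notation C := R[i].
Local Notation idx := (@mxvec_index d d).
Local Notation monomials := ({ffun 'I_d -> 'I_4} * 'S_d)%type.
Implicit Types (A : 'M[C]_d) (X Y : 'M[C]_(d * d)).

(** Addition in ['I_4] is modulo 4, so this is a character. Signs alone would not be enough: they
    square to 1 and cannot kill the entries at row (i, j) and column (j, i). *)
Definition phase (a : 'I_4) : C := 'i%C ^+ a.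

Lemma phaseD a b : phase (a + b) = phase a * phase b.
Proof.
rewrite /phase -exprD /=; apply: expr_mod.
by rewrite -[4%N]/(2 * 2)%N exprM sqr_i sqrrN expr1n.
Qed.

Lemma norm_phase a : phase a * (phase a)^*%C = 1.
Proof.
rewrite /phase rmorphXn -exprMn_comm; last exact: mulrC.
rewrite -sqr_normc normc_def /= expr0n expr1n add0r sqrtr1.
by rewrite !expr1n.
Qed.

Definition monomial_mx (g : monomials) : 'M[C]_d :=
  diag_mx (\row_i phase (g.1 i)) *m perm_mx g.2.

Lemma unitary_monomial g : unitary (monomial_mx g).
Proof.
apply: unitaryM; last exact: unitary_perm_mx.
rewrite /unitary; apply/matrixP=> i j; rewrite mul_diag_mx mxE adjE !mxE.
case: eqVneq => [->|ne]; first by rewrite !mulr1n norm_phase.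
by rewrite !mulr0n conjc0 mulr0.
Qed.

Lemma monomial_conjE g A i j :
  (monomial_mx g *m A *m adj (monomial_mx g)) i j
    = phase (g.1 i) * A (g.2 i) (g.2 j) * (phase (g.1 j))^*%C.
Proof.
have rowE B k l : (monomial_mx g *m B) k l = phase (g.1 k) * B (g.2 k) l.
  by rewrite -mulmxA mul_diag_mx -row_permE !mxE.
have -> : monomial_mx g *m A *m adj (monomial_mx g)
          = monomial_mx g *m adj (monomial_mx g *m adj A).
  by rewrite adjM adjK mulmxA.
rewrite rowE adjE rowE adjE rmorphM /= conjcK.
by rewrite -mulrA [_^*%C * _]mulrC.
Qed.

(** A plain sum: the order of the group is divided out only in [mixed_twirl_rho]. *)
Definition twirl A : 'M[C]_(d * d) :=
  \sum_g vec (monomial_mx g *m A *m adj (monomial_mx g)) *m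
         adj (vec (monomial_mx g *m A *m adj (monomial_mx g))).

Lemma twirlE A i j k l : twirl A (idx i j) (idx k l) =
  \sum_(g : monomials) phase (g.1 i) * A (g.2 i) (g.2 j) * (phase (g.1 j))^*%C *
    (phase (g.1 k) * A (g.2 k) (g.2 l) * (phase (g.1 l))^*%C)^*%C.
Proof.
by rewrite summxE; apply: eq_bigr => g _; rewrite dyadE !monomial_conjE.
Qed.

Lemma twirl_in_cone alpha A :
  admissible d alpha (vec A) -> in_cone alpha (twirl A).
Proof.
move=> adA; exists monomials, (fun=> 1).
exists (fun g => vec (monomial_mx g *m A *m adj (monomial_mx g))).
split=> // [g|]; first by apply: admissible_conj => //; exact: unitary_monomial.
by apply: eq_bigr => g _; rewrite rmorph1 scale1r.
Qed.

(* The first clause expresses invariance under diagonal phases, the second one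
   under permutations. *)
Definition monomial_invariant X : Prop :=
  (forall i j k l, ~~ ((i == j) && (k == l) || (i == k) && (j == l)) ->
     X (idx i j) (idx k l) = 0) /\
  (forall (t : 'S_d) i j k l,
     X (idx (t i) (t j)) (idx (t k) (t l)) = X (idx i j) (idx k l)).

Lemma monomial_invariantD X Y :
  monomial_invariant X -> monomial_invariant Y -> monomial_invariant (X + Y).
Proof.
move=> [X0 Xp] [Y0 Yp]; split=> [i j k l ne|t i j k l]; rewrite !mxE.
  by rewrite X0 // Y0 // addr0.
by rewrite Xp Yp.
Qed.

Lemma monomial_invariantZ a X :
  monomial_invariant X -> monomial_invariant (a *: X).
Proof.
move=> [X0 Xp]; split=> [i j k l ne|t i j k l]; rewrite !mxE.
  by rewrite X0 // mulr0.
by rewrite Xp.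
Qed.

(* Reindexing the average by the phase that multiplies the coordinate m by i. *)
Lemma twirl_phase A (m i j k l : 'I_d) :
  let e (n : 'I_d) : C := if n == m then 'i%C else 1 in
  twirl A (idx i j) (idx k l)
    = e i * (e j)^*%C * (e k)^*%C * e l * twirl A (idx i j) (idx k l).
Proof.
move=> e; pose delta : {ffun 'I_d -> 'I_4} := [ffun n => if n == m then 1 else 0].
have shiftE (f : {ffun 'I_d -> 'I_4}) n :
    phase ((f + delta) n) = phase (f n) * e n.
  rewrite ffunE phaseD; congr (_ * _).
  by rewrite ffunE /e /phase; case: eqP; rewrite ?expr1 ?expr0.
pose h (g : monomials) : monomials := (g.1 + delta, g.2).
have h_inj : injective h.
  by move=> [f s] [f' s'] [/addIr <- <-].
rewrite twirlE [LHS](reindex_inj h_inj) mulr_sumr; apply: eq_bigr => -[f s] _ /=.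
by rewrite !shiftE !rmorphM /= !conjcK; ring.
Qed.

Lemma twirl_invariant A : monomial_invariant (twirl A).
Proof.
have i_neq1 : 'i%C != 1 :> C by rewrite eq_complex /= eq_sym oner_eq0.
have sqi_neq1 : -1 != 1 :> C.
  by rewrite -subr_eq0 -opprD oppr_eq0 -mulr2n mulrn_eq0 oner_eq0.
have fixed0 (a x : C) : a != 1 -> x = a * x -> x = 0.
  move=> a1 /eqP; rewrite -subr_eq0 -{1}[x]mul1r -mulrBl mulf_eq0 subr_eq0.
  by rewrite eq_sym (negPf a1) => /eqP.
have conji : ('i%C : C)^*%C = - 'i%C by apply/eqP; rewrite eq_complex /= oppr0 !eqxx.
have ii : 'i%C * 'i%C = -1 :> C by rewrite -expr2 sqr_i.
split=> [i j k l ne|t i j k l].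
  (* If i equals j or k, then l is unpaired and the phase at l multiplies the entry by the imaginary
     unit. Otherwise the phase at i does so, or multiplies it by -1 when i = l. *)
  have [im|im] := boolP ((i == j) || (i == k)).
    have := twirl_phase A l i j k l; rewrite /= eqxx; apply: fixed0.
    move: ne im; case: (eqVneq i j) => [<-|ij] /=.
      move=> /norP[kl _] _; rewrite (negPf kl) conjc1.
      case: (i == l); rewrite ?conjc1 ?mulr1 ?mul1r ?mulr1 //.
      by rewrite conji mulrN ii opprK mul1r.
    case: (eqVneq i k) => [<-|//] /= jl _.
    rewrite (negPf jl) conjc1 mulr1.
    case: (i == l); rewrite ?conjc1 ?mulr1 ?mul1r ?mulr1 //.
    by rewrite conji mulrN ii opprK mul1r.
  have := twirl_phase A i i j k l; rewrite /= eqxx; apply: fixed0.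
  case/norP: im => ij ik; rewrite ![_ == i]eq_sym (negPf ij) (negPf ik).
  rewrite conjc1 !mulr1; case: (i == l); rewrite ?mulr1 //.
  by rewrite ii.
(* Left translation by the inverse of the permutation [t], which moves the phases along with the
   indices. *)
pose h (g : monomials) : monomials := ([ffun n => g.1 ((t^-1)%g n)], (t^-1 * g.2)%g).
have h_inj : injective h.
  move=> [f s] [f' s'] [/ffunP ff /mulgI <-]; congr (_, _).
  by apply/ffunP=> n; have := ff (t n); rewrite !ffunE permK.
rewrite !twirlE [LHS](reindex_inj h_inj); apply: eq_bigr => -[f s] _ /=.
by rewrite !ffunE !permM !permK.
Qed.

Lemma twirl_sum_diag A :
  \sum_i \sum_k twirl A (idx i i) (idx k k) = #|{: monomials}|%:R * `|\tr A| ^+ 2.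
Proof.
under eq_bigr do under eq_bigr do rewrite summxE.
under eq_bigr do rewrite exchange_big /=.
rewrite exchange_big /= mulr_natl -sumr_const; apply: eq_big => // g _.
by rewrite sum_diag_dyad (tr_conj A (unitary_monomial g)).
Qed.

Lemma twirl_trace A : unit_vec (vec A) -> \tr (twirl A) = #|{: monomials}|%:R.
Proof.
move=> nA; rewrite raddf_sum -sumr_const; apply: eq_big => // g _.
by rewrite /= trace_dyad //; apply: unit_vec_conj => //; exact: unitary_monomial.
Qed.

(** Phases cancel on the diagonal and permutations only reorder it. A general unitary conjugation
    does change this quantity, which leaves room to adjust it. *)
Lemma twirl_sum_diag_sqr A :
  \sum_i twirl A (idx i i) (idx i i)
    = #|{: monomials}|%:R * \sum_i `|A i i| ^+ 2.
Proof.
under eq_bigr do rewrite summxE.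
rewrite exchange_big /= mulr_natl -sumr_const; apply: eq_big => // g _.
rewrite [RHS](reindex_inj (@perm_inj _ g.2)) /=; apply: eq_bigr => i _.
rewrite dyadE -sqr_normc monomial_conjE mulrAC norm_phase mul1r //.
Qed.

End Twirl.

(** * Recognizing isotropic states among monomial invariants *)

Section Isotropic.
Variables (R : realType) (d : nat).
Hypothesis d_gt1 : (1 < d)%N.
Local Notation C := R[i].
Local Notation idx := (@mxvec_index d d).
Implicit Types (X : 'M[C]_(d * d)) (F : R).

Lemma sum_if_eq (i : 'I_d) (x y : C) :
  \sum_(k < d) (if i == k then y else x) = y + (d%:R - 1) * x.
Proof.
rewrite (bigD1 i) //= eqxx; congr (_ + _).
rewrite (eq_bigr (fun=> x)) => [|k]; last by rewrite eq_sym => /negPf ->.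
by rewrite sumr_const cardC1 card_ord mulrBl mul1r mulr_natl -subn1 mulrnBr // ltnW.
Qed.

Lemma rhoE F i j k l : rho d F (idx i j) (idx k l) =
  ((1 - F) / (d%:R ^+ 2 - 1))%:C%C * ((i == k) && (j == l))%:R
  + (F - (1 - F) / (d%:R ^+ 2 - 1))%:C%C
    * (d%:R^-1 *+ ((i == j) && (k == l))).
Proof.
rewrite mxE [X in X + _]mxE [X in _ + X]mxE [X in _ * X]mxE.
rewrite [X in _ * (_ + X)]mxE P_omegaE mxE mxvec_index_eq [in RHS]rmorphB /=.
by ring.
Qed.

(** Double transitivity: one transposition sends i to i', and a second one corrects the image of k
    while fixing i'. *)
Lemma transitive_pair (i k i' k' : 'I_d) : i != k -> i' != k' ->
  exists t : 'S_d, t i = i' /\ t k = k'.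
Proof.
move=> ik ik'; exists (tperm i i' * tperm (tperm i i' k) k')%g.
rewrite !permM tpermL; split; last by rewrite tpermL.
apply: tpermD; last by rewrite eq_sym.
by rewrite -[X in _ == X](tpermL i i') (inj_eq perm_inj) eq_sym.
Qed.

(** Invariance leaves three free entries [x], [y], [z], one per orbit of index pairs, and the three
    sums form an invertible linear system for them. The second value prescribed is the one that
    [rho d F] itself has. *)
Lemma monomial_invariant_rho X F : monomial_invariant X ->
  \sum_i \sum_k X (idx i i) (idx k k) = (d%:R * F)%:C%C ->
  \sum_i X (idx i i) (idx i i) = ((d%:R * F + 1) / (d%:R + 1))%:C%C ->
  \tr X = 1 -> X = rho d F.
Proof.
move=> [X0 Xt].
have [i0 [i1 i01]] : exists i0 i1 : 'I_d, i0 != i1.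
  by exists (Ordinal (ltnW d_gt1)), (Ordinal d_gt1).
pose x := X (idx i0 i0) (idx i1 i1); pose y := X (idx i0 i0) (idx i0 i0).
pose z := X (idx i0 i1) (idx i0 i1).
have Xy i : X (idx i i) (idx i i) = y by rewrite /y -(Xt (tperm i0 i) i0) tpermL.
have Xx i k : i != k -> X (idx i i) (idx k k) = x.
  by move=> ik; have [t [<- <-]] := transitive_pair i01 ik; rewrite Xt.
have Xz i k : i != k -> X (idx i k) (idx i k) = z.
  by move=> ik; have [t [<- <-]] := transitive_pair i01 ik; rewrite Xt.
have -> : \sum_i \sum_k X (idx i i) (idx k k) = d%:R * (y + (d%:R - 1) * x).
  rewrite (eq_bigr (fun=> y + (d%:R - 1) * x)) => [|i _].
    by rewrite sumr_const card_ord mulr_natl.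
  rewrite -(sum_if_eq i); apply: eq_bigr => k _.
  by case: eqVneq => [<-|/Xx].
have -> : \sum_i X (idx i i) (idx i i) = d%:R * y.
  by rewrite (eq_bigr (fun=> y)) // sumr_const card_ord mulr_natl.
have -> : \tr X = d%:R * (y + (d%:R - 1) * z).
  rewrite /mxtrace big_mxvec (eq_bigr (fun=> y + (d%:R - 1) * z)) => [|i _].
    by rewrite sumr_const card_ord mulr_natl.
  rewrite -(sum_if_eq i); apply: eq_bigr => k _.
  by case: eqVneq => [<-|/Xz].
have dR : 1 < d%:R :> R by rewrite ltr1n.
have d0 : (d%:R : C) != 0 by rewrite pnatr_eq0; lia.
have d1 : (d%:R - 1 : C) != 0.
  by rewrite subr_eq0 -[1]/(1%:R) eqr_nat; lia.
have d2 : (d%:R + 1 : C) != 0.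
  by rewrite -[1]/(1%:R) -natrD pnatr_eq0; lia.
rewrite !(rmorphM, rmorphD, fmorphV, rmorph_nat, rmorph1) /= => ex ey ez.
(* The system is triangular: [y] comes from the second sum, then [x] from the first and [z] from the
   trace. *)
have yE : y = (d%:R * F%:C%C + 1) / (d%:R + 1) / d%:R by rewrite -ey; field.
have xE : x = (d%:R * F%:C%C / d%:R - y) / (d%:R - 1) by rewrite -ex; field; apply/andP.
have zE : z = (d%:R^-1 - y) / (d%:R - 1).
  by rewrite -[d%:R^-1]mulr1 -[X in _^-1 * X]ez; field; apply/andP.
have d3 : (d%:R ^+ 2 - 1 : C) != 0.
  have -> : d%:R ^+ 2 - 1 = (d%:R - 1) * (d%:R + 1) :> C by ring.
  by rewrite mulf_neq0.
apply/matrixP => a b; case/mxvec_indexP: a => i j; case/mxvec_indexP: b => k l.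
rewrite rhoE !(rmorphB, rmorphM, fmorphV, rmorphXn, rmorph_nat, rmorph1) /=.
have [/andP[/eqP <- /eqP <-]|ijkl] := boolP ((i == j) && (k == l)).
  rewrite mulr1n andbb; case: (eqVneq i k) => [<-|ik].
    by rewrite Xy yE mulr1n; field; rewrite d0 d2 d3.
  by rewrite Xx // xE yE mulr0n; field; rewrite d0 d1 d2 d3.
rewrite mulr0n mulr0 addr0.
have [/andP[/eqP ik /eqP jl]|ikjl] := boolP ((i == k) && (j == l)).
  rewrite -ik -jl mulr1n Xz ?zE ?yE; first by field; rewrite d0 d1 d2 d3.
  by move: ijkl; rewrite -ik -jl andbb.
by rewrite mulr0n mulr0 X0 // negb_or ijkl ikjl.
Qed.

End Isotropic.

(** * A unitary matrix with entries of equal modulus *)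

Section Fourier.
Variables (R : realType) (d : nat).
Hypothesis d_gt0 : (0 < d)%N.
Local Notation C := R[i].

(** The polynomial ['X^d - 1] splits with d distinct roots, and that many roots of unity of order
    dividing d include a primitive one. *)
Lemma complex_prim_root : exists z : C, d.-primitive_root z.
Proof.
have [r Er] := closed_field_poly_normal ('X^d - 1 : {poly C}).
rewrite (monicP _) ?monicXnsubC // scale1r in Er.
suff /hasP[z _ prim_z] : has d.-primitive_root r by exists z.
apply: has_prim_root => //.
- by apply/allP=> z; rewrite -root_prod_XsubC -Er.
- by rewrite -separable_prod_XsubC -Er separable_Xn_sub_1 // pnatr_eq0 -lt0n.
- by have := size_prod_XsubC r id; rewrite -Er size_XnsubC // => -[->].
Qed.

(* The witness is the Fourier matrix. *)
Lemma exists_flat_unitary : exists U : 'M[C]_d,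
  unitary U /\ forall i j, U i j * (U i j)^*%C = d%:R^-1.
Proof.
have [z prim_z] := complex_prim_root.
have dN0 : (d%:R : C) != 0 by rewrite pnatr_eq0 -lt0n.
have zz : z * z^*%C = 1.
  rewrite -sqr_normc; have /eqP := congr1 Num.norm (prim_expr_order prim_z).
  by rewrite normrX normr1 pexpr_eq1 // => /eqP ->; rewrite expr1n.
have zXX n : z ^+ n * (z ^+ n)^*%C = 1.
  by rewrite rmorphXn -exprMn_comm ?zz ?expr1n //; exact: mulrC.
pose U : 'M[C]_d := \matrix_(i, j) (isqrt_dim R d * z ^+ (i * j)).
have UU i j k l : U i j * (U k l)^*%C
    = d%:R^-1 * (z ^+ (i * j) * (z ^+ (k * l))^*%C).
  rewrite !mxE rmorphM [X in _ * (X * _)]conjc_real -isqrt_dim_sqr.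
  by rewrite mulrACA.
exists U; split=> [|i j]; last by rewrite UU zXX mulr1.
rewrite /unitary; apply/matrixP=> i k; rewrite !mxE.
pose w := z ^+ i * (z ^+ k)^*%C.
rewrite (eq_bigr (fun j : 'I_d => d%:R^-1 * w ^+ j)) => [|j _]; last first.
  by rewrite adjE UU !exprM rmorphXn -exprMn_comm //; exact: mulrC.
rewrite -mulr_sumr; case: eqVneq => [ik|ne_ik].
  rewrite (eq_bigr (fun=> 1)) => [|j _]; last by rewrite /w ik zXX expr1n.
  by rewrite sumr_const card_ord mulVf.
have w1 : w != 1.
  apply: contra ne_ik => /eqP w1.
  have : z ^+ i == z ^+ k.
    by rewrite -[z ^+ k]mul1r -w1 /w -mulrA [_^*%C * _]mulrC zXX mulr1.
  by rewrite (eq_prim_root_expr prim_z) !modn_small.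
have wd : w ^+ d = 1.
  rewrite /w exprMn_comm; last exact: mulrC.
  have conjX (x : C) n : (x ^+ n)^*%C = x^*%C ^+ n by exact: rmorphXn.
  rewrite -conjX -!exprM !(mulnC _ d) !exprM (prim_expr_order prim_z).
  by rewrite !expr1n conjc1 mulr1.
(* The geometric sum times [w - 1] is [w ^+ d - 1 = 0], and [w] differs from 1. *)
have /eqP := subrX1 w d; rewrite wd subrr eq_sym mulf_eq0 subr_eq0 (negPf w1) /=.
by move=> /eqP ->; rewrite mulr0.
Qed.

End Fourier.

(** * Both directions of the criterion for isotropic states *)

Section Mixture.
Variables (R : realType) (d : nat).
Hypothesis d_gt1 : (1 < d)%N.
Local Notation C := R[i].
Implicit Types (A B : 'M[C]_d) (F : R).

Lemma convex_between (a b c : R) : a <= c <= b ->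
  exists p, 0 <= p <= 1 /\ p * a + (1 - p) * b = c.
Proof.
move=> /andP[ac cb]; have [ab|ab] := eqVneq a b.
  by exists 0; split; lra.
have ba : 0 < b - a by rewrite subr_gt0 lt_neqAle ab; lra.
exists ((b - c) / (b - a)); split; last by field; rewrite gt_eqF.
by rewrite divr_ge0 ?ler_pdivrMr //; lra.
Qed.

(** The normalized twirls agree in trace and in overlap with [omega]; only q differs, and the weight
    p interpolates it to the isotropic value. *)
Lemma mixed_twirl_rho alpha A B F (q q' : R) :
  admissible d alpha (vec A) -> admissible d alpha (vec B) ->
  `|\tr A| ^+ 2 = (d%:R * F)%:C%C -> `|\tr B| ^+ 2 = (d%:R * F)%:C%C ->
  \sum_i `|A i i| ^+ 2 = q%:C%C -> \sum_i `|B i i| ^+ 2 = q'%:C%C ->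
  q <= (d%:R * F + 1) / (d%:R + 1) <= q' ->
  in_cone alpha (rho d F).
Proof.
move=> adA adB trA trB qA qB /convex_between[p [p01 pE]].
set N : R := #|{: {ffun 'I_d -> 'I_4} * 'S_d}|%:R.
have N0 : 0 < N by rewrite ltr0n; apply/card_gt0P; exists ([ffun=> 0], 1%g).
have NC : #|{: {ffun 'I_d -> 'I_4} * 'S_d}|%:R = N%:C%C by rewrite rmorph_nat.
have NC0 : N%:C%C != 0 :> C by rewrite fmorph_eq0 gt_eqF.
have [nA _] := adA; have [nB _] := adB.
move: (twirl_in_cone adA) (twirl_invariant A) (twirl_sum_diag A)
      (twirl_sum_diag_sqr A) (twirl_trace nA).
move: (twirl_in_cone adB) (twirl_invariant B) (twirl_sum_diag B)
      (twirl_sum_diag_sqr B) (twirl_trace nB).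
rewrite trA trB qA qB NC.
(* Forget [twirl]: rewriting with [mxE] would otherwise unfold it. *)
move: (twirl A) (twirl B) => X Y coneY invY tY qY nY coneX invX tX qX nX.
have <- : (p / N)%:C%C *: X + ((1 - p) / N)%:C%C *: Y = rho d F.
  apply: monomial_invariant_rho => //.
  - by apply: monomial_invariantD; apply: monomial_invariantZ.
  - under eq_bigr do under eq_bigr do rewrite !mxE.
    under eq_bigr do rewrite big_split /= -!mulr_sumr.
    rewrite big_split /= -!mulr_sumr tX tY -!rmorphM -rmorphD.
    by congr (_%:C%C); field; rewrite gt_eqF.
  - under eq_bigr do rewrite !mxE.
    rewrite big_split /= -!mulr_sumr qX qY -!rmorphM -rmorphD.
    by rewrite -pE; congr (_%:C%C); field; rewrite gt_eqF.
  - rewrite mxtraceD !mxtraceZ nX nY -!rmorphM -rmorphD.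
    by rewrite -[RHS](rmorph1 (real_complex R)); congr (_%:C%C); field; rewrite gt_eqF.
by apply: in_coneD; apply: in_coneZ => //; apply: divr_ge0; lra.
Qed.

Lemma rho_fd_in_cone k theta : (0 < k <= d)%N -> 0 <= theta < 1 ->
  (k = d -> theta = 0) ->
  in_cone (k%:R + theta) (rho d (fd d (k%:R + theta) : R)).
Proof.
move=> kd th kdth; have d_gt0 := ltnW d_gt1.
have [v [adv trv qv]] := extremal_admissible d_gt0 kd th kdth.
have [U [uU flatU]] := exists_flat_unitary R d_gt0.
have d1 : 1 <= d%:R :> R by rewrite ler1n.
have k1 : 1 <= k%:R :> R by rewrite ler1n; case/andP: kd.
set F := fd d _ in trv *.
have F1 : F <= 1.
  rewrite /F fd_natD // ler_pdivrMr ?mul1r; last first.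
    by apply: mulr_gt0; [lra | rewrite ltr_wpDr ?sqr_ge0 //; lra].
  have [kd'|kd'] := eqVneq k d; first by rewrite kdth // kd' expr0n !addr0 expr2.
  (* Here [k + 1 <= d], and [(k + 1) (k + theta^2) - (k + theta)^2 = k (1 - theta)^2]. *)
  have : (k%:R + 1) * (k%:R + theta ^+ 2) <= d%:R * (k%:R + theta ^+ 2).
    rewrite ler_wpM2r ?addr_ge0 ?sqr_ge0 ?ler0n //.
    by rewrite natr1 ler_nat; lia.
  have : 0 <= k%:R * (1 - theta) ^+ 2 by rewrite mulr_ge0 ?sqr_ge0 ?ler0n.
  by nra.
apply: (@mixed_twirl_rho _ (U *m diag_mx v *m adj U) (diag_mx v) _ F 1) => //.
- exact: admissible_conj.
- by rewrite tr_conj.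
(* Flatness of [U] makes every diagonal entry the mean of [v], so q is the squared trace over d,
   that is [F]. *)
- have E i : (U *m diag_mx v *m adj U) i i = d%:R^-1 * \tr (diag_mx v).
    rewrite mxE mulr_sumr; apply: eq_bigr => j _.
    by rewrite mul_mx_diag mxE adjE mulrAC flatU !mxE eqxx.
  under eq_bigr do rewrite E.
  rewrite sumr_const card_ord normrM exprMn trv normfV normr_nat.
  rewrite -mulr_natl rmorphM rmorph_nat /= expr2; field.
  by rewrite pnatr_eq0 -lt0n.
- by rewrite rmorph1 -qv; apply: eq_bigr => i _; rewrite mxE eqxx.
(* Both inequalities reduce to [F <= 1]. *)
- by rewrite ler_pdivlMr ?ler_pdivrMr; nra.
Qed.

Lemma rho_0_in_cone k theta : (0 < k <= d)%N -> 0 <= theta < 1 ->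
  in_cone (k%:R + theta) (rho d (0 : R)).
Proof.
move=> /andP[k_gt0 _] th; have d_gt0 := ltnW d_gt1.
have [U [uU flatU]] := exists_flat_unitary R d_gt0.
pose i0 := Ordinal d_gt0; pose i1 := Ordinal d_gt1.
have adE := @delta_admissible R d k theta i0 i1 k_gt0 th erefl.
have trE : \tr (delta_mx i0 i1 : 'M[C]_d) = 0.
  rewrite /mxtrace big1 // => i _; rewrite mxE.
  by case: (eqVneq i i0) => [->|].
have d1 : 1 <= d%:R :> R by rewrite ler1n.
apply: (@mixed_twirl_rho _ (delta_mx i0 i1) (U *m delta_mx i0 i1 *m adj U)
          _ 0 (d%:R^-1)) => //.
- exact: admissible_conj.
- by rewrite trE normr0 expr0n mulr0.
- by rewrite tr_conj // trE normr0 expr0n mulr0.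
- rewrite big1 // => i _; rewrite mxE.
  by case: (eqVneq i i0) => [->|] /=; rewrite normr0 expr0n.
- have E i : (U *m delta_mx i0 i1 *m adj U) i i = U i i0 * (U i i1)^*%C.
    rewrite mxE (bigD1 i1) //= big1 => [|j ne_j].
      rewrite addr0 adjE mxE (bigD1 i0) //= big1 => [|l ne_l].
        by rewrite addr0 mxE !eqxx mulr1.
      by rewrite mxE (negPf ne_l) mulr0.
    rewrite mxE big1 ?mul0r // => l _.
    by rewrite mxE (negPf ne_j) andbF mulr0.
  under eq_bigr do rewrite E normrM exprMn normcJ !sqr_normc !flatU.
  rewrite sumr_const card_ord -mulr_natl fmorphV rmorph_nat; field.
  by rewrite pnatr_eq0 -lt0n.
- rewrite mulr0 add0r mul1r invr_ge0 lef_pV2 ?posrE; lra.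
Qed.

(** The state is affine in [F], so the two endpoints suffice. *)
Lemma rho_in_cone k theta F : (0 < k <= d)%N -> 0 <= theta < 1 ->
  (k = d -> theta = 0) -> 0 <= F <= fd d (k%:R + theta) ->
  in_cone (k%:R + theta) (rho d F).
Proof.
move=> kd th kdth /convex_between[p [p01 <-]].
set f := fd d _.
have -> : rho d (p * 0 + (1 - p) * f)
          = p%:C%C *: rho d 0 + (1 - p)%:C%C *: rho d f.
  rewrite /rho; move: (1%:M - P_omega R d) => M.
  rewrite !scalerDr !scalerA -!rmorphM addrACA -!scalerDl -!rmorphD.
  by congr (_ *: _ + _); apply: congr1; ring.
apply: in_coneD; apply: in_coneZ; try lra.
  exact: rho_0_in_cone.
exact: rho_fd_in_cone.
Qed.

(** The functional [g] separates: it is nonpositive on the cone, and an explicit Lipschitz constant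
    carries this to the closure. *)
Lemma in_K_rho_le k theta F : (0 < k <= d)%N -> 0 <= theta < 1 ->
  in_K d (k%:R + theta) (rho d F) -> F <= fd d (k%:R + theta).
Proof.
move=> kd th inK.
have ub psi := @qform_P_omega_admissible_le R d (ltnW d_gt1) k theta psi kd th.
set f := fd d _ in ub *.
have f0 : 0 <= f.
  apply: fd_ge0; have : 1 <= k%:R :> R by rewrite ler1n; case/andP: kd.
  lra.
clearbody f.
have d0 : (d%:R : C) != 0 by rewrite pnatr_eq0; lia.
have dR : 2 <= d%:R :> R by rewrite ler_nat.
have d0R : 0 < d%:R :> R by lra.
pose S (X : 'M[C]_(d * d)) : C :=
  \sum_i \sum_j X (mxvec_index i i) (mxvec_index j j).
have SD X Y : S (X + Y) = S X + S Y.
  rewrite -big_split /=; apply: eq_bigr => i _; rewrite -big_split /=.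
  by apply: eq_bigr => j _; rewrite mxE.
have SZ a X : S (a *: X) = a * S X.
  rewrite mulr_sumr; apply: eq_bigr => i _; rewrite mulr_sumr.
  by apply: eq_bigr => j _; rewrite mxE.
pose g X : C := d%:R^-1 * S X - f%:C%C * \tr X.
have gD X Y : g (X + Y) = g X + g Y by rewrite /g SD mxtraceD; ring.
have gZ a X : g (a *: X) = a * g X by rewrite /g SZ mxtraceZ; ring.
have g0 : g 0 = 0 by rewrite -[0 in LHS](scale0r 0) gZ mul0r.
have grho : g (rho d F) = (F - f)%:C%C.
  have S1 : S 1%:M = d%:R.
    rewrite -[d in RHS]card_ord -sumr_const; apply: eq_big => // i _.
    rewrite (bigD1 i) //= mxE eqxx big1 ?addr0 // => j ne_ji.
    by rewrite mxE mxvec_index_eq eq_sym (negPf ne_ji).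
  have SP : S (P_omega R d) = d%:R.
    rewrite -[d in RHS]card_ord -sumr_const; apply: eq_big => // i _.
    under eq_bigr do rewrite P_omegaE !eqxx mulr1n.
    by rewrite sumr_const card_ord -[d%:R^-1 *+ _]mulr_natl mulfV.
  have tP : \tr (P_omega R d) = 1.
    rewrite /mxtrace big_mxvec -[RHS](mulfV d0) mulr_natl.
    rewrite -[X in _ *+ X](card_ord d) -sumr_const; apply: eq_big => // i _.
    rewrite (bigD1 i) //= P_omegaE eqxx mulr1n big1 ?addr0 // => j ne_ji.
    by rewrite P_omegaE eq_sym (negPf ne_ji).
  rewrite /g /rho SD !SZ SD -[- P_omega R d]scaleN1r SZ SP S1.
  rewrite mxtraceD !mxtraceZ mxtraceD mxtraceZ tP.
  rewrite mxtrace1 natrM !(rmorphB, rmorphM, fmorphV, rmorphXn, rmorph_nat, rmorph1) /=.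
  field; rewrite d0 /=.
  have -> : d%:R ^+ 2 - 1 = (d%:R - 1) * (d%:R + 1) :> C by ring.
  rewrite andbT; apply: mulf_neq0; last by rewrite natr1 pnatr_eq0.
  by rewrite subr_eq0 (eqr_nat C d 1); lia.
have g_dyad psi : admissible d (k%:R + theta) psi -> g (psi *m adj psi) <= 0.
  move=> ad_psi; have := ub psi ad_psi.
  rewrite /g /S -[psi]coef_mxK; case: ad_psi => nu _.
  rewrite sum_diag_dyad trace_dyad ?coef_mxK //.
  by rewrite -{1}[psi]coef_mxK qform_P_omega mulr1 subr_le0 mulrC.
(* Lipschitz constant of [g] for the largest entry: [S] and the trace each add up d^2 entries, with
   weights [d^-1] and [f]. *)
pose K := d%:R * d%:R * (d%:R^-1 + f).
have K0 : 0 <= K by rewrite !mulr_ge0 ?addr_ge0 ?invr_ge0 ?ler0n.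
have g_bound (X : 'M[C]_(d * d)) (e : R) :
    (forall i j, `|X i j| <= e%:C%C) -> `|g X| <= (K * e)%:C%C.
  move=> Xe; apply: le_trans (ler_normB _ _) _.
  have sum_le (Z : 'I_d -> 'I_d -> C) : (forall i j, `|Z i j| <= e%:C%C) ->
      `|\sum_i \sum_j Z i j| <= d%:R * d%:R * e%:C%C.
    move=> Ze; rewrite -mulrA !mulr_natl.
    rewrite -[X in _ <= _ *+ X](card_ord d) -sumr_const.
    apply: le_trans (ler_norm_sum _ _ _) _; apply: ler_sum => i _.
    rewrite -[X in _ <= _ *+ X](card_ord d) -sumr_const.
    by apply: le_trans (ler_norm_sum _ _ _) _; apply: ler_sum => j _.
  have -> : (K * e)%:C%C = d%:R^-1 * (d%:R * d%:R * e%:C%C)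
                         + f%:C%C * (d%:R * d%:R * e%:C%C).
    rewrite !(rmorphD, rmorphM, fmorphV, rmorph_nat) /=; ring.
  apply: lerD; rewrite normrM.
    rewrite normfV normr_nat ler_wpM2l ?invr_ge0 ?ler0n //.
    by apply: sum_le.
  rewrite ger0_norm ?lecR // ler_wpM2l ?lecR //.
  by rewrite /mxtrace big_mxvec; apply: sum_le.
rewrite leNgt; apply/negP => ltfF.
(* With this tolerance [g] moves by less than [F - f], whereas going from a point of the cone to
   [rho d F] requires at least [F - f]. *)
have [|n [c [phi [c0 ad_phi close]]]] := inK ((F - f) / (K + 1)).
  by rewrite divr_gt0 //; lra.
move: close; set Y := \sum_l _ => close.
have gY : g Y <= 0.
  rewrite /Y (big_morph g gD g0) -oppr_ge0 -sumrN; apply: sumr_ge0 => l _.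
  by rewrite gZ -mulrN mulr_ge0 ?lecR // oppr_ge0 g_dyad.
have /g_bound : forall i j, `|(rho d F - Y) i j| <= ((F - f) / (K + 1))%:C%C.
  by move=> i j; rewrite mxE [X in _ + X]mxE; apply: ltW; exact: close.
have gB : g (rho d F - Y) = (F - f)%:C%C - g Y by rewrite gD -[- Y]scaleN1r gZ grho mulN1r.
have le_g : (F - f)%:C%C <= g (rho d F - Y) by rewrite gB lerBrDr gerDl.
have Ff0 : 0 <= (F - f)%:C%C :> C by rewrite lecR; lra.
rewrite ger0_norm ?(le_trans Ff0) // => /(le_trans le_g).
rewrite lecR mulrCA leNgt => /negP; apply.
rewrite gtr_pMr ?subr_gt0 // ltr_pdivrMr; lra.
Qed.

End Mixture.

Theorem theorem4p6 (R : realType) (d : nat) (hd : (2 <= d)%N) :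
  (forall alpha : R, 1 <= alpha <= d%:R ->
     mu d alpha (P_omega R d) = fd d alpha /\
     (forall F : R, 0 <= F <= 1 ->
        (in_K d alpha (rho d F) <-> F <= fd d alpha))) /\
  (forall k : nat, (1 <= k <= d)%N -> fd d (k%:R : R) = k%:R / d%:R).
Proof.
split=> [alpha /archi_split[k [theta [-> kd th kdth]]]|k /andP[k_gt0 _]].
  split=> [|F /andP[F0 _]]; first by apply: mu_P_omega => //; exact: ltnW.
  split=> [|Ff]; first exact: in_K_rho_le.
  by apply/in_cone_in_K/rho_in_cone => //; rewrite F0.
by apply: fd_nat => //; exact: ltnW.
Qed.
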